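(* If a dynamical system $(X,f)$ has the asymptotic average shadowing property, then it also has the average shadowing property.
   Context: A dynamical system $(X,f)$ is a compact metric space $(X,d)$ together with a continuous map $f\colon X\to X$ (not assumed surjective). A sequence $\{x_i\}_{i=0}^\infty\subset X$ is: a $\delta$-average-pseudo-orbit of $f$ if there is $N>0$ such that $\frac1n\sum_{i=0}^{n-1}d(f(x_{i+k}),x_{i+k+1})<\delta$ for all $n\ge N$ and all integers $k\ge0$; an asymptotic average pseudo-orbit of $f$ if $\lim_{n\to\infty}\frac1n\sum_{i=0}^{n-1}d(f(x_i),x_{i+1})=0$. $(X,f)$ has the average shadowing property if for every $\varepsilon>0$ there is $\delta>0$ such that for every $\delta$-average-pseudo-orbit $\{x_i\}_{i=0}^\infty$ there is $z\in X$ with $\limsup_{n\to\infty}\frac1n\sum_{i=0}^{n-1}d(f^i(z),x_i)<\varepsilon$. $(X,f)$ has the asymptotic average shadowing property if for every asymptotic average pseudo-orbit $\{x_i\}_{i=0}^\infty$ there is $z\in X$ with $\lim_{n\to\infty}\frac1n\sum_{i=0}^{n-1}d(f^i(z),x_i)=0$. *)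

(* Defs.v *)
From HB Require Import structures.
From mathcomp Require Import all_boot all_order all_algebra.
From mathcomp Require Import all_classical all_reals all_analysis.

Set Implicit Arguments.
Unset Strict Implicit.
Unset Printing Implicit Defensive.

Import Order.TTheory GRing.Theory Num.Theory.
Import numFieldNormedType.Exports.

Local Open Scope classical_set_scope.
Local Open Scope ring_scope.

(* The library's [arithmetic_mean u n] averages [n.+1] terms; here exactly the
   first [n] terms are averaged (and the value at [n = 0] is [0]). *)
Definition mean {R : realType} (u : nat -> R) (n : nat) : R :=
  n%:R^-1 * \sum_(i < n) u i.

Definition dynamical_system {R : realType} (X : metricType R) (f : X -> X) :
    Prop :=
  compact [set: X] /\ continuous f.

Definition average_pseudo_orbit {R : realType} {X : metricType R}
    (f : X -> X) (delta : R) (x : nat -> X) : Prop :=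
  exists2 N : nat, (0 < N)%N &
    forall n k : nat, (N <= n)%N ->
      mean (fun i => mdist (f (x (i + k)%N)) (x (i + k).+1)) n < delta.

Definition asymptotic_average_pseudo_orbit {R : realType} {X : metricType R}
    (f : X -> X) (x : nat -> X) : Prop :=
  mean (fun i => mdist (f (x i)) (x i.+1)) @ \oo --> (0 : R).

(* The limsup is taken in the extended reals, where it always exists. *)
Definition average_shadowing {R : realType} {X : metricType R} (f : X -> X) :
    Prop :=
  forall eps : R, 0 < eps ->
    exists2 delta : R, 0 < delta &
      forall x : nat -> X, average_pseudo_orbit f delta x ->
        exists z : X,
          (limn_esup (fun n => (mean (fun i => mdist (iter i f z) (x i)) n)%:E)
             < eps%:E)%E.

Definition asymptotic_average_shadowing {R : realType} {X : metricType R}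
    (f : X -> X) : Prop :=
  forall x : nat -> X, asymptotic_average_pseudo_orbit f x ->
    exists z : X, mean (fun i => mdist (iter i f z) (x i)) @ \oo --> (0 : R).

(* Main.v *)
Require Import Defs.
From mathcomp Require Import all_boot all_order all_algebra.
From mathcomp Require Import all_classical all_reals all_analysis.
From mathcomp Require Import lra.

Import Order.TTheory GRing.Theory Num.Theory.
Import numFieldNormedType.Exports.

Local Open Scope classical_set_scope.
Local Open Scope ring_scope.

(** Suppose average shadowing fails for some [eps].  Then for each [m] there is
    a [1/(m+1)]-average-pseudo-orbit [y m] such that no orbit follows it with
    upper mean error below [eps].  Running the [y m] one after the other, [y m]
    (from its index [0]) during the block of times [T m, T m.+1), gives a single
    sequence [w].  For blocks growing fast enough, [w] is an asymptotic average
    pseudo-orbit that no orbit shadows on average, so the asymptotic average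
    shadowing property fails too.

    The lengths of the blocks serve two purposes.

    - The first [n] errors of [y m] sum to at most [C m + n/(m+1)] for some
      constant [C m] ([pseudo_orbit_error_le]), and a junction of two blocks
      costs at most the diameter [D] of the space.  If [T m.+1] dominates what
      has accumulated by time [T m], together with [C m], [C m.+1] and the
      junctions, then the mean error of [w] is at most [2/(m+1)] from time
      [T m.+1] on ([mean_cvg0_of_blocks]).  Accounting for [C m.+1] one block
      in advance is what controls the mean at the start of a block, where the
      errors of [y m.+1] can still be large.

    - For each point [z] and each [M], the mean distance from the orbit of [z]
      to [y m] exceeds [eps/2] at some time [n >= M].  The set of such [z] is
      open for each [n], so by compactness all the points are handled by
      [M <= n <= N] for some [N] ([compact_frequently_open]).  With [M := T m]
      and a block longer than [N], this applies to the point reached at time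
      [T m] by the orbit that is supposed to follow [w].  Since [n >= T m], the
      excess [n * eps/2] collected inside the block still gives a mean of at
      least [eps/4] over the whole time [T m + n]. *)

(** * Distances in a compact metric space *)

Lemma continuous_mdist (R : realType) (X : metricType R) (a : X) :
  continuous (fun z : X => mdist z a).
Proof.
move=> z; apply/cvgrPdist_lt => e e0.
apply: filterS (@nbhsx_ballx _ _ z e e0) => t; rewrite ballEmdist /= => zt.
have := metric_triangle z t a; have := metric_triangle t z a.
by rewrite (metric_sym t z) => h1 h2; rewrite ltr_norml; apply/andP; split; lra.
Qed.

Lemma compact_mdist_bounded (R : realType) (X : metricType R) :
  compact [set: X] -> exists D : R, forall a b : X, mdist a b <= D.
Proof.
move=> cX; have [[a0 _]|X0] := pselect (exists _ : X, True); last first.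
  by exists 0 => a; case: X0; exists a.
have cv : forall x : X, [set: X] x ->
    \forall x' \near x & N \near \oo, mdist x' a0 < N%:R :> R.
  move=> x _.
  exists ([set x' | mdist x' a0 < mdist x a0 + 1],
          [set N | mdist x a0 + 1 <= N%:R :> R]).
    split=> /=; last exact: nbhs_infty_ger.
    by apply: (cvgr_lt _ (continuous_mdist R X a0 x)); rewrite ltrDl.
  by move=> [x' N] /= [h1 h2]; apply: lt_le_trans h2.
have [N _ HN] := proj1 (compact_near_coveringP _) cX _ _ _ _ cv.
exists (N%:R + N%:R) => a b; apply: le_trans (metric_triangle a a0 b) _.
rewrite (metric_sym a0 b).
by apply: lerD; apply: ltW; exact: (HN N (leqnn _)).
Qed.

Lemma continuous_orbit_dist_sum (R : realType) (X : metricType R) (f : X -> X)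
    (x : nat -> X) (n : nat) : continuous f ->
  continuous (fun z => \sum_(i < n) mdist (iter i f z) (x i)).
Proof.
move=> cf; have ci : forall i, continuous (iter i f).
  elim=> [|i ih] z /=; first exact: cvg_id.
  by apply: continuous_comp; [exact: ih | exact: cf].
elim: n => [|n ih] z.
  by under eq_fun do rewrite big_ord0; exact: cvg_cst.
under eq_fun do rewrite big_ord_recr /=.
apply: cvgD; first exact: ih.
by apply: (@continuous_comp _ _ _ (iter n f) (fun z => mdist z (x n)));
  [exact: ci | exact: continuous_mdist].
Qed.

(** * Escape at frequent times *)

Lemma frequently_gt_of_limn_esup (R : realType) (u : nat -> R) (b c : R) :
  b < c -> (c%:E <= limn_esup (fun n => (u n)%:E))%E ->
  forall M, exists2 n, (M <= n)%N & b < u n.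
Proof.
move=> bc cu M; apply: contrapT => nex.
have : (limn_esup (fun n => (u n)%:E) <= b%:E)%E.
  apply: (@le_trans _ _ (ereal_sup [set (u n)%:E | n in [set n | (M <= n)%N]])).
    by apply: ereal_inf_lbound; exists [set n | (M <= n)%N] => //; exact: nbhs_infty_ge.
  apply: ge_ereal_sup => _ [n Mn <-]; rewrite lee_fin leNgt.
  by apply/negP => bu; apply: nex; exists n.
by move=> /(le_trans cu); rewrite lee_fin leNgt bc.
Qed.

(** Uniformity from compactness: [n <= N] is monotone in [N], so the local
    choices of [n] near finitely many points can be merged into one window. *)
Lemma compact_frequently_open (X : topologicalType) (U : nat -> set X) :
  compact [set: X] -> (forall n, open (U n)) ->
  (forall z M, exists2 n, (M <= n)%N & U n z) ->
  forall M, exists N, forall z, exists2 n, (M <= n <= N)%N & U n z.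
Proof.
move=> cX oU fU M.
have cv : forall x : X, [set: X] x -> \forall x' \near x & N \near \oo,
    exists2 n, (M <= n <= N)%N & U n x'.
  move=> x _; have [n Mn Unx] := fU x M.
  exists (U n, [set N | (n <= N)%N]).
    by split=> /=; [exact: open_nbhs_nbhs | exact: nbhs_infty_ge].
  by move=> [x' N] /= [h1 h2]; exists n => //; rewrite Mn.
have [N _ HN] := proj1 (compact_near_coveringP _) cX _ _ _ _ cv.
by exists N => z; exact: (HN N (leqnn _)).
Qed.

(** * Concatenation along an increasing sequence of times *)

Lemma exists_block (T : nat -> nat) (n : nat) :
  T 0 = 0%N -> (forall m, T m < T m.+1)%N -> exists m, (T m <= n < T m.+1)%N.
Proof.
move=> T0 incT; elim: n => [|n [m /andP[Tmn nT]]].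
  by exists 0%N; have := incT 0%N; rewrite T0.
have [lt|ge] := ltnP n.+1 (T m.+1); first by exists m; rewrite (leqW Tmn).
by exists m.+1; rewrite ge; apply: leq_ltn_trans (incT m.+1).
Qed.

Lemma concatenation (A : Type) (T : nat -> nat) (y : nat -> nat -> A) :
  T 0 = 0%N -> (forall m, T m < T m.+1)%N ->
  exists w : nat -> A,
    forall m r, (T m + r < T m.+1)%N -> w (T m + r)%N = y m r.
Proof.
move=> T0 incT.
have [idx idxP] := choice (fun n => exists_block T n T0 incT).
exists (fun n => y (idx n) (n - T (idx n))%N) => m r rT.
suff -> : idx (T m + r)%N = m by rewrite addKn.
have leT : {homo T : a b / (a <= b)%N}.
  by apply: homo_leq leqnn leq_trans _ => i; exact: ltnW.
have /andP[h1 h2] := idxP (T m + r)%N.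
apply/eqP; rewrite eqn_leq; apply/andP; split; rewrite leqNgt; apply/negP => lt.
- by have := leq_ltn_trans (leq_trans (leT _ _ lt) h1) rT; rewrite ltnn.
- have := leq_ltn_trans (leq_addr r (T m)) (leq_trans h2 (leT _ _ lt)).
  by rewrite ltnn.
Qed.

(** * Errors of pseudo-orbits and of their concatenations *)

(** The averages are controlled only from some length [K] on; the constant
    absorbs the sum of the first [K] errors, which bounds all shorter sums
    because the errors are nonnegative. *)
Lemma pseudo_orbit_error_le (R : realType) (X : metricType R) (f : X -> X)
    (delta : R) (x : nat -> X) : 0 < delta -> average_pseudo_orbit f delta x ->
  exists C : R, forall n,
    \sum_(i < n) mdist (f (x i)) (x i.+1) <= C + n%:R * delta.
Proof.
move=> d0 [K K0 KP]; exists (\sum_(i < K) mdist (f (x i)) (x i.+1)) => n.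
have s0 m : 0 <= \sum_(i < m) mdist (f (x i)) (x i.+1).
  by apply: sumr_ge0 => i _; exact: mdist_ge0.
have [Kn|/ltnW nK] := leqP K n; last first.
  rewrite -(subnKC nK) big_split_ord /= -addrA lerDl addr_ge0 //.
    by apply: sumr_ge0 => i _; exact: mdist_ge0.
  by rewrite mulr_ge0 // ltW.
have := KP n 0%N Kn; rewrite /mean.
under eq_bigr do rewrite addn0.
rewrite mulrC ltr_pdivrMr ?ltr0n ?(leq_trans K0 Kn) // => /ltW h.
by have := s0 K; lra.
Qed.

(** A sequence that on the block [T m, T m.+1) has mean at most [delta m] up to
    an additive constant [C m] has mean tending to [0], provided each block is
    long with respect to the past and to the constant of the block that comes
    next.  The reason: by time [T p.+1] the sum together with [C p.+1] is at
    most [2 * T p.+1 * delta p], one half for the new block and one half, by the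
    growth condition, for the rest; this constant paid, the next block adds at
    most [delta p.+1 <= delta p] per step. *)
Lemma mean_cvg0_of_blocks (R : realType) (e : nat -> R) (D : R)
    (delta C : nat -> R) (T : nat -> nat) :
  nonincreasing_seq delta -> delta @ \oo --> (0 : R) ->
  T 0 = 0%N -> (forall m, T m < T m.+1)%N -> (forall j, 0 <= e j <= D) ->
  (forall m r, (T m + r <= T m.+1)%N ->
     \sum_(i < r) e (T m + i)%N <= C m + r%:R * delta m) ->
  (forall m, D * (T m)%:R + C m + C m.+1 <= (T m.+1)%:R * delta m) ->
  mean e @ \oo --> (0 : R).
Proof.
move=> decd cvd T0 incT eD blk growth.
have d0 m : 0 <= delta m.
  have <- : limn delta = 0 by exact/cvg_lim.
  by apply: nonincreasing_cvgn_ge => //; apply/cvg_ex; exists 0.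
have leT : {homo T : a b / (a <= b)%N}.
  by apply: homo_leq leqnn leq_trans _ => i; exact: ltnW.
have sumE m r : \sum_(i < T m + r) e i =
    \sum_(i < T m) e i + \sum_(i < r) e (T m + i)%N by rewrite big_split_ord.
have sumD n : \sum_(i < n) e i <= D * n%:R.
  rewrite mulr_natr -[X in D *+ X]card_ord -sumr_const; apply: ler_sum => i _.
  by have /andP[] := eD i.
have key m n : (T m.+1 <= n)%N -> \sum_(i < n) e i <= 2 * (n%:R * delta m).
  move=> Tn; have [p /andP[Tp nT]] := exists_block T n T0 incT.
  (* The block [p] of [n] comes after the block [m], so it has a predecessor,
     whose growth condition can be used. *)
  case: p Tp nT => [|p] Tp nT.
    by have := leq_ltn_trans (leq_trans (leT 1%N m.+1 isT) Tn) nT; rewrite ltnn.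
  have mp : (m <= p)%N.
    rewrite leqNgt; apply/negP => pm.
    by have := leq_ltn_trans (leq_trans (leT p.+2 m.+1 pm) Tn) nT; rewrite ltnn.
  have [r nE] : exists r, n = (T p.+1 + r)%N by exists (n - T p.+1)%N; rewrite subnKC.
  have Tp1 : T p.+1 = (T p + (T p.+1 - T p))%N by rewrite subnKC // ltnW.
  have h1 : \sum_(i < T p.+1) e i <= D * (T p)%:R + (C p + (T p.+1)%:R * delta p).
    rewrite Tp1 sumE lerD ?sumD //.
    apply: (le_trans (blk p (T p.+1 - T p)%N _)); first by rewrite -Tp1.
    by rewrite lerD2l ler_wpM2r // ler_nat -Tp1 leq_subr.
  have h2 := blk p.+1 r; rewrite -nE in h2; have {}h2 := h2 (ltnW nT).
  have h3 := growth p.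
  have h4 : r%:R * delta p.+1 <= r%:R * delta p by rewrite ler_wpM2l // decd.
  have h5 : n%:R * delta p <= n%:R * delta m by rewrite ler_wpM2l // decd.
  have h6 : n%:R * delta p = (T p.+1)%:R * delta p + r%:R * delta p.
    by rewrite nE natrD mulrDl.
  have h7 : 0 <= r%:R * delta p by rewrite mulr_ge0.
  have -> : \sum_(i < n) e i =
      \sum_(i < T p.+1) e i + \sum_(i < r) e (T p.+1 + i)%N by rewrite nE sumE.
  by lra.
apply/cvgr0Pnorm_lt => eps eps0.
have eps2 : 0 < eps / 2 by rewrite divr_gt0.
have [m _ /(_ m (leqnn m)) /= dm] := proj1 (cvgr0Pnorm_lt _) cvd _ eps2.
exists (T m.+1) => //= n /= Tn.
have n0 : 0 < n%:R :> R.
  by rewrite ltr0n; apply: leq_trans Tn; apply: leq_ltn_trans (incT m).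
rewrite /mean ger0_norm; last first.
  by rewrite mulr_ge0 ?invr_ge0 //; apply: sumr_ge0 => i _; have /andP[] := eD i.
rewrite mulrC ltr_pdivrMr // mulrC; apply: le_lt_trans (key m n Tn) _.
rewrite mulrCA ltr_pM2l // mulrC -ltr_pdivlMr //.
by apply: le_lt_trans dm; exact: ler_norm.
Qed.

(** Inside a block the errors of [w] are those of [y m], except at the last
    step, where [w] jumps to the next sequence: hence [C m + D] in place of
    [C m]. *)
Lemma concatenation_asymptotic (R : realType) (X : metricType R) (f : X -> X)
    (D : R) (delta C : nat -> R) (T : nat -> nat) (y : nat -> nat -> X)
    (w : nat -> X) :
  nonincreasing_seq delta -> delta @ \oo --> (0 : R) ->
  (forall a b : X, mdist a b <= D) ->
  (forall m n, \sum_(i < n) mdist (f (y m i)) (y m i.+1) <=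
     C m + n%:R * delta m) ->
  T 0 = 0%N -> (forall m, T m < T m.+1)%N ->
  (forall m r, (T m + r < T m.+1)%N -> w (T m + r)%N = y m r) ->
  (forall m, D * (T m)%:R + (C m + D) + (C m.+1 + D) <= (T m.+1)%:R * delta m) ->
  asymptotic_average_pseudo_orbit f w.
Proof.
move=> decd cvd DP CP T0 incT wP growth.
apply: (mean_cvg0_of_blocks R _ D delta (fun m => C m + D) T) => //.
  by move=> j; rewrite mdist_ge0 DP.
move=> m [|r] rT.
  rewrite big_ord0; have := CP m 0%N; rewrite big_ord0 mul0r => h.
  have := le_trans (mdist_ge0 (w 0%N) (w 0%N)) (DP _ _); lra.
rewrite big_ord_recr /= addrAC lerD //; apply: le_trans (CP m r.+1).
rewrite big_ord_recr /= -[X in X <= _]addr0 lerD ?mdist_ge0 //.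
apply: ler_sum => i _; rewrite -addnS !wP //.
- by apply: leq_trans rT; rewrite ltn_add2l ltnS.
- by apply: leq_trans rT; rewrite ltn_add2l ltnW // ltnS.
Qed.

Theorem theorem4p2 (R : realType) (X : metricType R) (f : X -> X)
    (dsXf : dynamical_system f) :
  asymptotic_average_shadowing f -> average_shadowing f.
Proof.
case: dsXf => cX cf aasp eps eps0; apply: contrapT => nsh.
have /choice[y yP] : forall m, exists x, average_pseudo_orbit f (harmonic m) x /\
    forall z, (eps%:E <=
      limn_esup (fun n => (mean (fun i => mdist (iter i f z) (x i)) n)%:E))%E.
  move=> m; apply: contrapT => nex; apply: nsh.
  exists (harmonic m); first exact: harmonic_gt0.
  move=> x xP; apply: contrapT => nz; apply: nex; exists x; split=> // z.
  by rewrite leNgt; apply/negP => lt; apply: nz; exists z.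
have /choice[C CP] : forall m, exists c : R, forall n,
    \sum_(i < n) mdist (f (y m i)) (y m i.+1) <= c + n%:R * harmonic m.
  move=> m; apply: pseudo_orbit_error_le; last exact: (yP m).1.
  exact: harmonic_gt0.
pose S m n z := \sum_(i < n) mdist (iter i f z) (y m i).
have /choice[N NP] : forall m, exists Nm : nat -> nat, forall M z,
    exists2 n, (M <= n <= Nm M)%N & n%:R * (eps / 2) < S m n z.
  move=> m; suff /choice[Nm NmP] : forall M, exists N, forall z,
      exists2 n, (M <= n <= N)%N & n%:R * (eps / 2) < S m n z by exists Nm.
  apply: (compact_frequently_open X (fun n z => n%:R * (eps / 2) < S m n z)) => //.
    move=> n; apply: (@open_comp _ _ (S m n) [set t | n%:R * (eps / 2) < t]).
      by move=> z _; exact: continuous_orbit_dist_sum.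
    exact: open_gt.
  move=> z M.
  have [|n Mn] := frequently_gt_of_limn_esup R _ (eps / 2) eps _ ((yP m).2 z) M.+1.
    by lra.
  have n0 : 0 < n%:R :> R by rewrite ltr0n (leq_trans _ Mn).
  by rewrite /mean [ltRHS]mulrC ltr_pdivlMr // mulrC => h; exists n => //; exact: ltnW.
have [D DP] := compact_mdist_bounded R X cX.
(* [N] makes the block longer than the window of escape that starts after the
   time [t] elapsed before it; [G] is what the error estimate demands. *)
pose G m t := Num.trunc ((D * t%:R + (C m + D) + (C m.+1 + D)) / harmonic m).
pose T := fix T m :=
  if m is m'.+1 then (T m' + N m' (T m') + (G m' (T m')).+1)%N else 0%N.
have incT m : (T m < T m.+1)%N by rewrite /= addnS ltnS -addnA leq_addr.
have TN m : (T m + N m (T m) < T m.+1)%N by rewrite /= addnS ltnS leq_addr.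
have [w wP] := concatenation X T y erefl incT.
have [|z zP] := aasp w.
  apply: (concatenation_asymptotic R X f D harmonic C T y) => //.
  - by move=> a b ab; rewrite lef_pV2 ?posrE ?ltr0Sn // ler_nat ltnS.
  - exact: cvg_harmonic.
  move=> m; rewrite -ler_pdivrMr ?harmonic_gt0 //; apply: ltW; apply: lt_le_trans (truncnS_gt _) _.
  by rewrite ler_nat /= leq_addl.
have e4 : 0 < eps / 4 by lra.
have [n0 _ n0P] := proj1 (cvgr0Pnorm_lt _) zP _ e4.
have geT m : (m <= T m)%N by elim: m => // m ih; exact: leq_ltn_trans (incT m).
(* The block [n0] starts at [T n0 >= n0], hence where the mean distance from the
   orbit of [z] to [w] is below [eps / 4]. *)
have [n /andP[Tn nN] lt] := NP n0 (T n0) (iter (T n0) f z).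
have n00 : (0 < n)%N.
  by case: n {Tn nN} lt => //; rewrite mul0r /S big_ord0 ltxx.
have := n0P (T n0 + n)%N (leq_trans (geT n0) (leq_addr _ _)).
rewrite /mean => /(le_lt_trans (ler_norm _)); apply/negP; rewrite -leNgt.
rewrite [leRHS]mulrC ler_pdivlMr ?ltr0n ?addn_gt0 ?n00 ?orbT //.
rewrite big_split_ord /=.
apply: (@le_trans _ _ (S n0 n (iter (T n0) f z))).
  apply: le_trans (ltW lt).
  (* [T n0 <= n]: the time before the block at most doubles the total time. *)
  have -> : n%:R * (eps / 2) = eps / 4 * (n%:R + n%:R) by lra.
  by rewrite ler_pM2l // natrD lerD2r ler_nat.
rewrite -[leLHS]add0r lerD //.
  by apply: sumr_ge0 => i _; exact: mdist_ge0.
apply: ler_sum => i _; rewrite wP; last first.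
  by apply: leq_ltn_trans (TN n0); rewrite leq_add2l (leq_trans (ltnW (ltn_ord i))).
by rewrite addnC iterD.
Qed.
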